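(* Let $r$ be a nonnegative integer and $\lambda\in\mathbb{R}$. For integers $n\ge l\ge0$, $${n+r+1 \brack l+r+1}_{r+1,\lambda}=\sum_{k=l}^{n}\binom{k}{l}\langle 1\rangle_{k-l,\lambda}{n+r \brack k+r}_{r,\lambda},$$ and $${n+r+1 \brace l+r+1}_{r+1,\lambda}=\sum_{j=l}^{n}\binom{n}{j}{j+r \brace l+r}_{r,\lambda}(1)_{n-j,\lambda}.$$
   Context: $(x)_{0,\lambda}=1$, $(x)_{n,\lambda}=x(x-\lambda)\cdots(x-(n-1)\lambda)$; $\langle x\rangle_{0,\lambda}=1$, $\langle x\rangle_{n,\lambda}=x(x+\lambda)\cdots(x+(n-1)\lambda)$; $(x)_n=(x)_{n,1}$, $\langle x\rangle_n=\langle x\rangle_{n,1}$. For a nonnegative integer $s$, the unsigned degenerate $s$-Stirling numbers of the first kind are defined by $\langle x+s\rangle_n=\sum_{k=0}^n{n+s \brack k+s}_{s,\lambda}\langle x\rangle_{k,\lambda}$ and the degenerate $s$-Stirling numbers of the second kind by $(x+s)_{n,\lambda}=\sum_{k=0}^n{n+s \brace k+s}_{s,\lambda}(x)_k$ (polynomial identities in $x$), with value $0$ when $k<0$ or $k>n$. *)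

(* Defs.v *)
From mathcomp Require Import all_boot all_order all_algebra.
From mathcomp Require Import boolp reals.

Set Implicit Arguments.
Unset Strict Implicit.
Unset Printing Implicit Defensive.

Import Order.TTheory GRing.Theory Num.Theory.
Local Open Scope ring_scope.

(* (x)_{n,lam} and <x>_{n,lam}; they are used both on numbers and, to state   *)
(* polynomial identities, on polynomials with lam a constant polynomial.      *)
(* The factorials (x)_n and <x>_n are the case lam = 1.                       *)
Definition dfalling (A : comNzRingType) (lam x : A) (n : nat) : A :=
  \prod_(i < n) (x - i%:R * lam).

Definition drising (A : comNzRingType) (lam x : A) (n : nat) : A :=
  \prod_(i < n) (x + i%:R * lam).

(* S N K stands for the symbol with upper entry N and lower entry K. Writing  *)
(* N = n + s and K = k + s, the vanishing clause says that the value is 0     *)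
(* when k < 0 or k > n; for N < s, where the symbol is not defined, it fixes  *)
(* the value 0.                                                               *)
Definition is_dstirling1 (R : realType) (s : nat) (lam : R)
    (S : nat -> nat -> R) : Prop :=
  (forall n : nat,
     drising 1 ('X + s%:R) n =
     \sum_(k < n.+1) S (n + s)%N (k + s)%N *: drising lam%:P 'X k) /\
  (forall N K : nat, ~~ (s <= K <= N)%N -> S N K = 0).

Definition is_dstirling2 (R : realType) (s : nat) (lam : R)
    (S : nat -> nat -> R) : Prop :=
  (forall n : nat,
     dfalling lam%:P ('X + s%:R) n =
     \sum_(k < n.+1) S (n + s)%N (k + s)%N *: dfalling 1 'X k) /\
  (forall N K : nat, ~~ (s <= K <= N)%N -> S N K = 0).

Section MonicBasis.
Variables (R : realType) (b : nat -> {poly R}).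
Hypothesis b_monic : forall k, b k \is monic.
Hypothesis size_b : forall k, size (b k) = k.+1.

Lemma monic_basis_expand n (p : {poly R}) : (size p <= n)%N ->
  exists c : nat -> R, p = \sum_(k < n) c k *: b k.
Proof.
elim: n p => [|n IHn] p szp.
  by exists (fun=> 0); rewrite big_ord0; apply/eqP; rewrite -size_poly_leq0.
have bn : (b n)`_n = 1 by have /monicP := b_monic n; rewrite lead_coefE size_b.
have [|c pE] := IHn (p - p`_n *: b n).
  apply/leq_sizeP => j; rewrite leq_eqVlt => /predU1P[<-|nj].
    by rewrite coefB coefZ bn mulr1 subrr.
  rewrite coefB coefZ [(b n)`_j]nth_default ?size_b // mulr0 subr0.
  by rewrite nth_default // (leq_trans szp).
exists (fun k => if k == n then p`_n else c k).
rewrite big_ord_recr /= eqxx; apply/eqP; rewrite -subr_eq pE; apply/eqP.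
by apply: eq_bigr => i _; rewrite ltn_eqF.
Qed.

Lemma monic_basis_uniq n (c d : nat -> R) :
  \sum_(k < n) c k *: b k = \sum_(k < n) d k *: b k ->
  forall k, (k < n)%N -> c k = d k.
Proof.
elim: n => [//|n IHn] cd.
have bn : (b n)`_n = 1 by have /monicP := b_monic n; rewrite lead_coefE size_b.
have coefn (e : nat -> R) : (\sum_(k < n.+1) e k *: b k)`_n = e n.
  rewrite big_ord_recr /= coefD coefZ bn mulr1 coef_sum big1 ?add0r // => i _.
  by rewrite coefZ nth_default ?mulr0 // size_b.
have cdn : c n = d n by rewrite -coefn cd coefn.
move: cd; rewrite !big_ord_recr /= cdn => /addIr/IHn {}IHn k.
by rewrite ltnS leq_eqVlt => /predU1P[->|/IHn].
Qed.

Lemma stirling_family_exists s (a : nat -> {poly R}) :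
    (forall n, (size (a n) <= n.+1)%N) ->
  exists S : nat -> nat -> R,
    (forall n, a n = \sum_(k < n.+1) S (n + s)%N (k + s)%N *: b k) /\
    (forall N K, ~~ (s <= K <= N)%N -> S N K = 0).
Proof.
move=> sza; have [c cE] := choice (fun n => monic_basis_expand (sza n)).
exists (fun N K => if (s <= K <= N)%N then c (N - s)%N (K - s)%N else 0).
split=> [n|N K /negbTE-> //]; rewrite [LHS]cE; apply: eq_bigr => k _.
by rewrite leq_addl leq_add2r -ltnS ltn_ord /= !addnK.
Qed.

Lemma stirling_family_uniq s (a : nat -> {poly R}) (S T : nat -> nat -> R) :
    (forall n, a n = \sum_(k < n.+1) S (n + s)%N (k + s)%N *: b k) /\
    (forall N K, ~~ (s <= K <= N)%N -> S N K = 0) ->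
    (forall n, a n = \sum_(k < n.+1) T (n + s)%N (k + s)%N *: b k) /\
    (forall N K, ~~ (s <= K <= N)%N -> T N K = 0) ->
  S = T.
Proof.
move=> [SE S0] [TE T0]; apply/funext => N; apply/funext => K.
have [/andP[sK KN]|nsKN] := boolP (s <= K <= N)%N; last by rewrite S0 ?T0.
have := SE (N - s)%N; rewrite TE subnK ?(leq_trans sK) //.
move/(@monic_basis_uniq _ (fun k => T N (k + s)%N) (fun k => S N (k + s)%N)).
by move/(_ (K - s)%N); rewrite subnK // => -> //; rewrite ltnS leq_sub2r.
Qed.

End MonicBasis.

Lemma dfalling_prod (R : realType) (lam c : R) n :
  dfalling lam%:P ('X + c%:P) n =
  \prod_(i < n) ('X - (i%:R * lam - c)%:P).
Proof.
by apply: eq_bigr => i _; rewrite polyCB polyCM polyC_natr opprB addrA.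
Qed.

Lemma drising_prod (R : realType) (lam c : R) n :
  drising lam%:P ('X + c%:P) n =
  \prod_(i < n) ('X - (- (i%:R * lam) - c)%:P).
Proof.
apply: eq_bigr => i _.
by rewrite polyCB polyCN polyCM polyC_natr opprD !opprK addrAC addrA.
Qed.

Lemma monic_dfalling (R : realType) (lam c : R) n :
  dfalling lam%:P ('X + c%:P) n \is monic.
Proof. by rewrite dfalling_prod monic_prod_XsubC. Qed.

Lemma size_dfalling (R : realType) (lam c : R) n :
  size (dfalling lam%:P ('X + c%:P) n) = n.+1.
Proof.
by rewrite dfalling_prod size_prod_XsubC /index_enum -enumT size_enum_ord.
Qed.

Lemma monic_drising (R : realType) (lam c : R) n :
  drising lam%:P ('X + c%:P) n \is monic.
Proof. by rewrite drising_prod monic_prod_XsubC. Qed.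

Lemma size_drising (R : realType) (lam c : R) n :
  size (drising lam%:P ('X + c%:P) n) = n.+1.
Proof.
by rewrite drising_prod size_prod_XsubC /index_enum -enumT size_enum_ord.
Qed.

Lemma monic_dfalling0 (R : realType) (lam : R) n :
  dfalling lam%:P 'X n \is monic.
Proof. by rewrite -['X]addr0 monic_dfalling. Qed.

Lemma size_dfalling0 (R : realType) (lam : R) n :
  size (dfalling lam%:P 'X n) = n.+1.
Proof. by rewrite -['X]addr0 size_dfalling. Qed.

Lemma monic_drising0 (R : realType) (lam : R) n :
  drising lam%:P 'X n \is monic.
Proof. by rewrite -['X]addr0 monic_drising. Qed.

Lemma size_drising0 (R : realType) (lam : R) n :
  size (drising lam%:P 'X n) = n.+1.
Proof. by rewrite -['X]addr0 size_drising. Qed.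

Lemma dstirling1_exists (R : realType) (s : nat) (lam : R) :
  exists S, is_dstirling1 s lam S.
Proof.
apply: (stirling_family_exists (monic_drising0 lam) (size_drising0 lam)) => n.
by rewrite -polyC1 -polyC_natr size_drising.
Qed.

Lemma dstirling2_exists (R : realType) (s : nat) (lam : R) :
  exists S, is_dstirling2 s lam S.
Proof.
apply: (stirling_family_exists (monic_dfalling0 1) (size_dfalling0 1)) => n.
by rewrite -polyC_natr size_dfalling.
Qed.

(* dstirling1 s lam N K is the unsigned degenerate s-Stirling number of the   *)
(* first kind with upper entry N and lower entry K; dstirling2 is the second  *)
(* kind. Each is the unique family with its defining property.                *)
Definition dstirling1 (R : realType) (s : nat) (lam : R) : nat -> nat -> R :=
  sval (cid (dstirling1_exists s lam)).

Definition dstirling2 (R : realType) (s : nat) (lam : R) : nat -> nat -> R :=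
  sval (cid (dstirling2_exists s lam)).

Lemma dstirling1P (R : realType) (s : nat) (lam : R) :
  is_dstirling1 s lam (dstirling1 s lam).
Proof. exact: svalP (cid (dstirling1_exists s lam)). Qed.

Lemma dstirling2P (R : realType) (s : nat) (lam : R) :
  is_dstirling2 s lam (dstirling2 s lam).
Proof. exact: svalP (cid (dstirling2_exists s lam)). Qed.

Lemma dstirling1_uniq (R : realType) (s : nat) (lam : R) S :
  is_dstirling1 s lam S -> S = dstirling1 s lam.
Proof.
move=> HS; apply: (stirling_family_uniq (monic_drising0 lam)
  (size_drising0 lam) HS (dstirling1P s lam)).
Qed.

Lemma dstirling2_uniq (R : realType) (s : nat) (lam : R) S :
  is_dstirling2 s lam S -> S = dstirling2 s lam.
Proof.
move=> HS; apply: (stirling_family_uniq (monic_dfalling0 1)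
  (size_dfalling0 1) HS (dstirling2P s lam)).
Qed.

(* Main.v *)
Require Import Defs.
From mathcomp Require Import all_boot all_order all_algebra.
From mathcomp Require Import boolp reals.
From mathcomp Require Import ring.

Set Implicit Arguments.
Unset Strict Implicit.
Unset Printing Implicit Defensive.

Import Order.TTheory GRing.Theory Num.Theory.
Local Open Scope ring_scope.

(* Both degenerate factorials are of binomial type, and both recurrences come *)
(* from the shift r -> r + t, at t = 1. For the first kind, substitute x + t  *)
(* for x in the expansion of <x + r>_n and expand each <x + t>_{k,lam}; for   *)
(* the second, expand ((x + r) + t)_{n,lam} and then each (x + r)_{j,lam}.    *)
(* Either way two triangular expansions are composed, and the coefficients    *)
(* are compared in the monic basis <x>_{l,lam}, respectively (x)_l.           *)

Lemma exchange_big_triangle (T : Type) (idx : T) (op : Monoid.com_law idx)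
    (F : nat -> nat -> T) n :
  \big[op/idx]_(k < n) \big[op/idx]_(l < k.+1) F k l =
  \big[op/idx]_(l < n) \big[op/idx]_(l <= k < n) F k l.
Proof.
under eq_bigr => k _ do rewrite (big_ord_widen _ (F k) (ltn_ord k)).
rewrite (exchange_big_dep predT) //=; apply: eq_bigr => l _.
by rewrite (big_nat_widenl l 0) // big_mkord.
Qed.

Lemma triangular_expansion_comp (A : pzRingType) (V : lmodType A)
    (c : nat -> A) (M : nat -> nat -> A) (e : nat -> V) n :
  \sum_(k < n) c k *: (\sum_(l < k.+1) M k l *: e l) =
  \sum_(l < n) (\sum_(l <= k < n) c k * M k l) *: e l.
Proof.
under eq_bigr do rewrite scaler_sumr.
rewrite (exchange_big_triangle _ (fun k l => c k *: (M k l *: e l))).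
apply: eq_bigr => l _; rewrite scaler_suml.
by apply: eq_bigr => k _; rewrite scalerA.
Qed.

Lemma dfallingS (A : comNzRingType) (lam x : A) n :
  dfalling lam x n.+1 = dfalling lam x n * (x - n%:R * lam).
Proof. exact: big_ord_recr. Qed.

Lemma drising_dfalling (A : comNzRingType) (lam x : A) n :
  drising lam x n = dfalling (- lam) x n.
Proof. by apply: eq_bigr => i _; rewrite mulrN opprK. Qed.

Lemma rmorph_dfalling (A B : comNzRingType) (f : {rmorphism A -> B}) lam x n :
  f (dfalling lam x n) = dfalling (f lam) (f x) n.
Proof.
rewrite rmorph_prod; apply: eq_bigr => i _.
by rewrite rmorphB rmorphM rmorph_nat.
Qed.

Lemma rmorph_drising (A B : comNzRingType) (f : {rmorphism A -> B}) lam x n :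
  f (drising lam x n) = drising (f lam) (f x) n.
Proof. by rewrite !drising_dfalling rmorph_dfalling rmorphN. Qed.

Lemma dfallingD (A : comNzRingType) (lam x y : A) n :
  dfalling lam (x + y) n =
  \sum_(i < n.+1) 'C(n, i)%:R * dfalling lam x i * dfalling lam y (n - i).
Proof.
elim: n => [|n IHn]; first by rewrite big_ord1 bin0 /dfalling !big_ord0 !mulr1.
rewrite dfallingS IHn mulr_suml.
(* x + y - n lam = (x - i lam) + (y - (n - i) lam) *)
transitivity (\sum_(i < n.+1)
    ('C(n, i)%:R * dfalling lam x i * dfalling lam y (n.+1 - i) +
     'C(n, i)%:R * dfalling lam x i.+1 * dfalling lam y (n - i))).
  apply: eq_bigr => i _; have le_in : (i <= n)%N by rewrite -ltnS.
  by rewrite subSn // !dfallingS natrB //; ring.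
rewrite big_split /= [RHS]big_ord_recl /= bin0.
under [in RHS]eq_bigr => i _ do
  rewrite /bump /= add1n binS natrD mulrDl mulrDl subSS.
rewrite big_split /= [X in _ = _ + (X + _)]big_ord_recr /= bin_small // !mul0r.
by rewrite addr0 addrA big_ord_recl /= bin0.
Qed.

Section PolynomialFactorials.
Variable A : comNzRingType.
Implicit Types (lam c : A) (p q : {poly A}).

Lemma dfallingD_polyC lam c p n :
  dfalling lam%:P (p + c%:P) n =
  \sum_(k < n.+1) ('C(n, k)%:R * dfalling lam c (n - k)) *: dfalling lam%:P p k.
Proof.
rewrite dfallingD; apply: eq_bigr => k _.
by rewrite -(rmorph_dfalling polyC) -mul_polyC polyCM polyC_natr mulrAC.
Qed.

Lemma drisingD_polyC lam c p n :
  drising lam%:P (p + c%:P) n =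
  \sum_(k < n.+1) ('C(n, k)%:R * drising lam c (n - k)) *: drising lam%:P p k.
Proof.
rewrite drising_dfalling -polyCN dfallingD_polyC.
by apply: eq_bigr => k _; rewrite !drising_dfalling polyCN.
Qed.

Lemma drising_comp_poly lam p q n :
  drising lam%:P p n \Po q = drising lam%:P (p \Po q) n.
Proof. by rewrite (rmorph_drising (comp_poly q)) /= comp_polyC. Qed.

End PolynomialFactorials.

Section DegenerateStirling.
Variables (R : realType) (lam : R).
Implicit Types (s r t n k l : nat) (c : nat -> R).

Lemma dstirling1_expansion_uniq s n c :
    drising 1 ('X + s%:R) n = \sum_(k < n.+1) c k *: drising lam%:P 'X k ->
  forall k, (k <= n)%N -> dstirling1 s lam (n + s) (k + s) = c k.
Proof.
have [-> _] := dstirling1P s lam.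
exact: (monic_basis_uniq (monic_drising0 lam) (size_drising0 lam)
  (c := fun k => dstirling1 s lam (n + s) (k + s))).
Qed.

Lemma dstirling2_expansion_uniq s n c :
    dfalling lam%:P ('X + s%:R) n = \sum_(k < n.+1) c k *: dfalling 1 'X k ->
  forall k, (k <= n)%N -> dstirling2 s lam (n + s) (k + s) = c k.
Proof.
have [-> _] := dstirling2P s lam.
exact: (monic_basis_uniq (monic_dfalling0 1) (size_dfalling0 1)
  (c := fun k => dstirling2 s lam (n + s) (k + s))).
Qed.

Lemma drising_sum_dstirling1 s n (p : {poly R}) :
  drising 1 (p + s%:R) n =
  \sum_(k < n.+1) dstirling1 s lam (n + s) (k + s) *: drising lam%:P p k.
Proof.
have [/(_ n) /(congr1 (comp_poly p)) + _] := dstirling1P s lam.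
rewrite -polyC1 drising_comp_poly rmorphD /= comp_polyX rmorph_nat => ->.
rewrite raddf_sum; apply: eq_bigr => k _ /=.
by rewrite linearZ /= drising_comp_poly comp_polyX.
Qed.

Lemma dstirling1_shift r t n l : (l <= n)%N ->
  dstirling1 (r + t) lam (n + (r + t)) (l + (r + t)) =
  \sum_(l <= k < n.+1)
    'C(k, l)%:R * drising lam t%:R (k - l) * dstirling1 r lam (n + r) (k + r).
Proof.
apply: (dstirling1_expansion_uniq (c := fun l => \sum_(l <= k < n.+1) _)).
rewrite (addnC r) natrD addrA drising_sum_dstirling1 -polyC_natr.
under eq_bigr do rewrite drisingD_polyC.
rewrite (triangular_expansion_comp
  (fun k => dstirling1 r lam (n + r) (k + r))
  (fun k l => 'C(k, l)%:R * drising lam t%:R (k - l))).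
by apply: eq_bigr => i _; under eq_bigr do rewrite mulrC.
Qed.

Lemma dstirling2_shift r t n l : (l <= n)%N ->
  dstirling2 (r + t) lam (n + (r + t)) (l + (r + t)) =
  \sum_(l <= j < n.+1)
    'C(n, j)%:R * dstirling2 r lam (j + r) (l + r) * dfalling lam t%:R (n - j).
Proof.
apply: (dstirling2_expansion_uniq (c := fun l => \sum_(l <= j < n.+1) _)).
rewrite natrD addrA -[t%:R]polyC_natr dfallingD_polyC.
have [dfalling_sum_dstirling2 _] := dstirling2P r lam.
under eq_bigr do rewrite dfalling_sum_dstirling2.
rewrite (triangular_expansion_comp
  (fun j => 'C(n, j)%:R * dfalling lam t%:R (n - j))
  (fun j l => dstirling2 r lam (j + r) (l + r))).
by apply: eq_bigr => i _; under eq_bigr do rewrite mulrAC.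
Qed.

End DegenerateStirling.

Theorem theorem11 (R : realType) (r : nat) (lam : R) (n l : nat)
    (hln : (l <= n)%N) :
  dstirling1 r.+1 lam (n + r + 1)%N (l + r + 1)%N =
    \sum_(l <= k < n.+1)
      'C(k, l)%:R * drising lam 1 (k - l) * dstirling1 r lam (n + r)%N (k + r)%N
  /\
  dstirling2 r.+1 lam (n + r + 1)%N (l + r + 1)%N =
    \sum_(l <= j < n.+1)
      'C(n, j)%:R * dstirling2 r lam (j + r)%N (l + r)%N * dfalling lam 1 (n - j).
Proof.
rewrite -[r.+1]addn1 -!addnA.
by split; [exact: dstirling1_shift | exact: dstirling2_shift].
Qed.
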